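(* Let $S = \langle n_1, \ldots, n_k\rangle$ be a numerical semigroup with fixed generators $n_1 < \cdots < n_k$, and let $f : \mathbb{Z} \to \mathbb{R}$ be an $S$-invariant. Then, as formal power series, $$\sum_{n \in S} f(n) t^n = z(t)\lambda(t) \sum_{n \in S} \chi(\Delta_n) t^n + z(t) \sum_{n \in S} \widehat\chi_f(\Delta_n) t^n = \lambda(t)\, \mathcal{H}(S;t) + \frac{\sum_{n \in S} \widehat\chi_f(\Delta_n) t^n}{(1 - t^{n_1}) \cdots (1 - t^{n_k})},$$ where $z(t) = \prod_{i=1}^k \frac{1}{1 - t^{n_i}}$, $\lambda(t) = \sum_{i=1}^k \frac{t^{n_i}}{1 - t^{n_i}}$, and $\mathcal{H}(S;t) = \sum_{n \in S} t^n$.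
   Context: A numerical semigroup is a subset $S \subseteq \mathbb{Z}_{\ge 0}$ containing $0$, closed under addition, with finite complement; $S = \langle n_1, \ldots, n_k\rangle$ means $S$ is generated by the positive integers $n_1 < \cdots < n_k$ (a fixed generating set). A function $f:\mathbb{Z} \to \mathbb{R}$ is an $S$-invariant if $f(n) = 0$ for all $n \notin S$. For $F \subseteq [k] = \{1,\ldots,k\}$ put $n_F = \sum_{i \in F} n_i$. For $n \in S$, the squarefree divisor complex $\Delta_n$ is the simplicial complex on $[k]$ whose faces are the $F \subseteq [k]$ (including $F = \emptyset$) with $n - n_F \in S$. The Euler characteristic used is $\chi(\Delta_n) = \sum_{F \in \Delta_n} (-1)^{|F|}$, and the augmented Euler characteristic of $\Delta_n$ with respect to $f$ is $$\widehat\chi_f(\Delta_n) = \sum_{F \in \Delta_n} (-1)^{|F|} \big(f(n - n_F) + |F|\big).$$ *)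

(* Defs.v *)
From HB Require Import structures.
From mathcomp Require Import all_boot all_order all_algebra.
From mathcomp Require Import boolp classical_sets functions cardinality reals.

Set Implicit Arguments.
Unset Strict Implicit.
Unset Printing Implicit Defensive.

Import Order.TTheory GRing.Theory Num.Theory.
Local Open Scope ring_scope.

(* [FPS c] is the series [sum_m (c m) t^m]. *)
Record fps (R : Type) : Type := FPS { fps_coef :> nat -> R }.

Lemma fpsP (R : Type) (p q : fps R) : p =1 q -> p = q.
Proof. by case: p q => [c] [d] /= /funext ->. Qed.

HB.instance Definition _ (R : Type) := gen_eqMixin (fps R).
HB.instance Definition _ (R : Type) := gen_choiceMixin (fps R).

Section FpsZmod.
Variable R : zmodType.
Implicit Types p q r : fps R.

Definition fps_zero : fps R := FPS (fun=> 0).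
Definition fps_opp p : fps R := FPS (fun m => - p m).
Definition fps_add p q : fps R := FPS (fun m => p m + q m).

Fact fps_addA : associative fps_add.
Proof. by move=> p q r; apply: fpsP => m /=; rewrite addrA. Qed.

Fact fps_addC : commutative fps_add.
Proof. by move=> p q; apply: fpsP => m /=; rewrite addrC. Qed.

Fact fps_add0 : left_id fps_zero fps_add.
Proof. by move=> p; apply: fpsP => m /=; rewrite add0r. Qed.

Fact fps_addN : left_inverse fps_zero fps_opp fps_add.
Proof. by move=> p; apply: fpsP => m /=; rewrite addNr. Qed.

HB.instance Definition _ := GRing.isZmodule.Build (fps R)
  fps_addA fps_addC fps_add0 fps_addN.

Lemma fps_coef0 m : (0 : fps R) m = 0. Proof. by []. Qed.
Lemma fps_coefN p m : (- p) m = - p m. Proof. by []. Qed.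
Lemma fps_coefD p q m : (p + q) m = p m + q m. Proof. by []. Qed.
Lemma fps_coefB p q m : (p - q) m = p m - q m. Proof. by []. Qed.

End FpsZmod.

Section FpsRing.
Variable R : comNzRingType.
Implicit Types p q r : fps R.

Definition fps_one : fps R := FPS (fun m => (m == 0)%:R).

Definition fps_mul p q : fps R :=
  FPS (fun m => \sum_(i < m.+1) p i * q (m - i)%N).

Definition fps_trunc m p : {poly R} := \poly_(i < m.+1) p i.

Fact coef_fps_trunc m p i : (i <= m)%N -> (fps_trunc m p)`_i = p i.
Proof. by move=> im; rewrite coef_poly ltnS im. Qed.

Fact fps_mulE m p q i :
  (i <= m)%N -> fps_mul p q i = (fps_trunc m p * fps_trunc m q)`_i.
Proof.
move=> im; rewrite coefM /=; apply: eq_bigr => j _.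
rewrite !coef_fps_trunc ?(leq_trans (leq_subr _ _) im) //.
by rewrite (leq_trans _ im) // -ltnS.
Qed.

Fact fps_mulC : commutative fps_mul.
Proof. by move=> p q; apply: fpsP => m; rewrite !(@fps_mulE m) // mulrC. Qed.

Fact fps_mulA : associative fps_mul.
Proof.
move=> p q r; apply: fpsP => m.
transitivity ((fps_trunc m p * (fps_trunc m q * fps_trunc m r))`_m).
  rewrite coefM; apply: eq_bigr => j _.
  rewrite (@coef_fps_trunc m p j); last by rewrite -ltnS.
  by rewrite (@fps_mulE m) // leq_subr.
rewrite mulrA coefM; apply: eq_bigr => j _.
rewrite (@coef_fps_trunc m r) ?leq_subr // (@fps_mulE m) //.
by rewrite -ltnS.
Qed.

Fact fps_mul1 : left_id fps_one fps_mul.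
Proof.
move=> p; apply: fpsP => m /=; rewrite big_ord_recl /= mul1r subn0.
by rewrite big1 ?addr0 // => i _; rewrite mul0r.
Qed.

Fact fps_mulDl : left_distributive fps_mul +%R.
Proof.
move=> p q r; apply: fpsP => m; rewrite fps_coefD /= -big_split /=.
by apply: eq_bigr => i _; rewrite -mulrDl.
Qed.

Fact fps_one_neq0 : fps_one != 0.
Proof.
apply/eqP => /(congr1 (fun p : fps R => p 0%N)) /= /eqP.
by rewrite (oner_eq0 R).
Qed.

HB.instance Definition _ := GRing.Zmodule_isComNzRing.Build (fps R)
  fps_mulA fps_mulC fps_mul1 fps_mulDl fps_one_neq0.

Definition fps_unit : {pred fps R} :=
  fun p => `[< exists q : fps R, q * p = 1 >].

Definition fps_inv p : fps R :=
  if pselect (exists q : fps R, q * p = 1) is left e then projT1 (cid e) else p.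

Fact fps_mulV : {in fps_unit, left_inverse 1 fps_inv *%R}.
Proof.
move=> p /asboolP up; rewrite /fps_inv; case: pselect => // e.
exact: (projT2 (cid e)).
Qed.

Fact fps_unitP p q : q * p = 1 -> fps_unit p.
Proof. by move=> qp; apply/asboolP; exists q. Qed.

Fact fps_inv_out : {in [predC fps_unit], fps_inv =1 id}.
Proof. by move=> p /asboolP np; rewrite /fps_inv; case: pselect. Qed.

HB.instance Definition _ := GRing.ComNzRing_hasMulInverse.Build (fps R)
  fps_mulV fps_unitP fps_inv_out.

Definition fps_t : fps R := FPS (fun m => (m == 1)%:R).

Lemma fps_coef1 m : (1 : fps R) m = (m == 0)%:R. Proof. by []. Qed.

Lemma fps_coefM p q m : (p * q) m = \sum_(i < m.+1) p i * q (m - i)%N.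
Proof. by []. Qed.

Lemma fps_coef_tXn d m : (fps_t ^+ d) m = (m == d)%:R.
Proof.
elim: d m => [|d IHd] m; first by rewrite expr0.
rewrite exprS fps_coefM; case: m => [|m].
  by rewrite big_ord_recl big_ord0 /= mul0r addr0.
rewrite 2!big_ord_recl /= mul0r add0r mul1r subn1 IHd eqSS.
by rewrite big1 ?addr0 // => i _; rewrite mul0r.
Qed.

Lemma fps_coef_tXnM d p m :
  (fps_t ^+ d * p) m = if (d <= m)%N then p (m - d)%N else 0.
Proof.
rewrite fps_coefM; case: leqP => dm; last first.
  rewrite big1 // => i _; rewrite fps_coef_tXn.
  case: eqP => [id|]; last by rewrite mul0r.
  by have := ltn_ord i; rewrite id ltnS leqNgt dm.
rewrite -ltnS in dm.
rewrite (bigD1 (Ordinal dm)) //= fps_coef_tXn eqxx mul1r big1 ?addr0 //.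
by move=> i /eqP/val_eqP /= /negbTE id; rewrite fps_coef_tXn id mul0r.
Qed.

(* So [(1 - fps_t ^+ d)^-1] is a genuine inverse, the geometric series. *)
Lemma fps_geometric d : (0 < d)%N ->
  FPS (fun m => (d %| m)%:R) * (1 - fps_t ^+ d) = 1 :> fps R.
Proof.
move=> d0; rewrite mulrC mulrBl mul1r; apply: fpsP => m.
rewrite fps_coefB fps_coef_tXnM fps_coef1 /=; case: leqP => dm.
  by rewrite dvdn_subl // subrr; case: m dm => //; rewrite leqNgt d0.
rewrite subr0; case: m dm => [|m] dm; first by rewrite dvdn0.
by rewrite gtnNdvd.
Qed.

Lemma fps_unit_1subtXn d :
  (0 < d)%N -> 1 - fps_t ^+ d \is a @GRing.unit (fps R).
Proof. by move=> /fps_geometric /fps_unitP. Qed.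

End FpsRing.

Arguments fps_t {R}.

Definition numerical_semigroup (S : set int) : Prop :=
  [/\ forall x, S x -> 0 <= x,
      S 0,
      forall x y, S x -> S y -> S (x + y)
    & finite_set [set x : int | 0 <= x /\ ~ S x]%classic].

Definition generated (k : nat) (n : 'I_k -> nat) : set int :=
  [set x : int | exists a : 'I_k -> nat, x = \sum_i (n i)%:Z *+ a i]%classic.

Definition semigroup_invariant (R : nmodType) (S : set int) (f : int -> R) : Prop :=
  forall x, ~ S x -> f x = 0.

(* [sum_(x in S) (g x) t^x], for a set [S] of nonnegative integers. *)
Definition series_over (R : nmodType) (S : set int) (g : int -> R) : fps R :=
  FPS (fun m => if m%:Z \in S then g m%:Z else 0).

Definition hilbert_series (R : comNzRingType) (S : set int) : fps R :=
  series_over S (fun=> 1).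

Section Complex.
Variables (k : nat) (n : 'I_k -> nat).

Definition gensum (F : {set 'I_k}) : int := \sum_(i in F) (n i)%:Z.

(* The complex is given by its set of faces, the empty face included. *)
Definition sqfree_divisor_complex (S : set int) (x : int) : {set {set 'I_k}} :=
  [set F : {set 'I_k} | x - gensum F \in S]%SET.

Definition euler_char (D : {set {set 'I_k}}) : int :=
  \sum_(F in D) (-1) ^+ #|F|.

Definition aug_euler_char (R : pzRingType) (S : set int) (f : int -> R) (x : int) : R :=
  \sum_(F in sqfree_divisor_complex S x)
    (-1) ^+ #|F| * (f (x - gensum F) + #|F|%:R).

End Complex.

(* Main.v *)
(* Multiplying a series supported on S by P = prod_i (1 - t^(n_i)), expanded as
   sum_F (-1)^|F| t^(n_F), turns its n-th coefficient into an alternating sum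
   over the faces of Delta_n.  Hence P H(S;t) is the generating series of
   chi(Delta_n).  Moreover sum_F (-1)^|F| |F| t^(n_F) = - P lambda, so the
   generating series of the augmented characteristic is
   P (sum_n f(n) t^n) - P lambda H(S;t), and both identities follow on
   dividing by P. *)
Require Import Defs.
From mathcomp Require Import all_boot all_order all_algebra.
From mathcomp Require Import boolp classical_sets reals.

Local Open Scope ring_scope.
Import Order.TTheory GRing.Theory Num.Theory.

Section SubsetExpansion.
Variables (A : comNzRingType) (I : finType) (y : I -> A).

Lemma prod_1sub_expand :
  \prod_i (1 - y i) = \sum_(F : {set I}) (-1) ^+ #|F| * \prod_(i in F) y i.
Proof.
under eq_bigr do rewrite addrC.
rewrite bigA_distr; apply: eq_bigr => F _.
by rewrite -prodrN [RHS]big_mkcond.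
Qed.

(** The [i]-th summand expands over the sets [F] containing [i], so in the sum over [i] each [F] is
    counted [#|F|] times. *)
Lemma sum_prod_1sub_expand :
  \sum_i y i * \prod_(j | j != i) (1 - y j) =
  - \sum_(F : {set I}) (-1) ^+ #|F| * #|F|%:R * \prod_(i in F) y i.
Proof.
have term i : y i * \prod_(j | j != i) (1 - y j) =
    - \sum_(F : {set I}) (i \in F)%:R * ((-1) ^+ #|F| * \prod_(j in F) y j).
  (* Replacing the 1 of the i-th factor by 0 keeps only the sets F containing i. *)
  have -> : y i * \prod_(j | j != i) (1 - y j) =
      - \prod_j (- y j + (j != i)%:R).
    rewrite [in RHS](bigD1 i) //= eqxx addr0 mulNr opprK; congr (_ * _).
    by apply: eq_bigr => j ->; rewrite addrC.
  rewrite bigA_distr; congr (- _); apply: eq_bigr => F _.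
  have [iF|iF] := boolP (i \in F).
    rewrite mul1r -prodrN [RHS]big_mkcond; apply: eq_bigr => j _.
    by case: ifP => // jF; case: eqP => // ji; rewrite ji iF in jF.
  by rewrite mul0r (bigD1 i) //= (negbTE iF) eqxx mul0r.
under eq_bigr do rewrite term.
rewrite sumrN exchange_big; congr (- _); apply: eq_bigr => F _ /=.
have -> : #|F|%:R = \sum_i (i \in F)%:R :> A.
  rewrite -sum1_card natr_sum big_mkcond.
  by apply: eq_bigr => i _; case: (i \in F).
by rewrite -mulr_suml mulrA [_ * (-1) ^+ _]mulrC.
Qed.

End SubsetExpansion.

Section FpsCoef.
Variable R : comNzRingType.

Lemma fps_coef_sum (J : finType) (P : pred J) (p : J -> fps R) m :
  (\sum_(j | P j) p j) m = \sum_(j | P j) p j m.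
Proof. exact: (big_morph (fun q : fps R => q m)). Qed.

Lemma fps_coef_signM a (p : fps R) m : ((-1) ^+ a * p) m = (-1) ^+ a * p m.
Proof. by rewrite -signr_odd -[in RHS]signr_odd !mulr_sign; case: odd. Qed.

Lemma fps_coef_natM a (p : fps R) m : (a%:R * p) m = a%:R * p m.
Proof.
rewrite !mulr_natl; elim: a => [|a IH]; first by rewrite !mulr0n.
by rewrite !mulrS fps_coefD IH.
Qed.

End FpsCoef.

Section FaceSums.
Variables (R : comNzRingType) (k : nat) (n : 'I_k -> nat) (S : set int).
Hypothesis S_ge0 : forall x, S x -> 0 <= x.
Hypothesis S_add : forall x y, S x -> S y -> S (x + y).
Hypothesis S_gensum : forall F, S (gensum n F).

Lemma gensumE F : gensum n F = (\sum_(i in F) n i)%N%:Z.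
Proof. by rewrite /gensum -natz natr_sum; apply: eq_bigr => i _; rewrite natz. Qed.

(** Multiplying by t^(n_F) shifts [g] by n_F, and the shifted term survives at m exactly when F is a
    face of Delta_m. The weight [w] covers both uses: constant 1 gives the expansion of P, and [id]
    gives that of -P lambda. *)
Lemma face_sum_series (w : nat -> nat) (g : int -> R) :
  (\sum_(F : {set 'I_k}) (-1) ^+ #|F| * (w #|F|)%:R * \prod_(i in F) fps_t ^+ n i)
    * series_over S g =
  series_over S (fun x => \sum_(F in sqfree_divisor_complex n S x)
    (-1) ^+ #|F| * (w #|F|)%:R * g (x - gensum n F)).
Proof.
apply: fpsP => m; rewrite mulr_suml fps_coef_sum.
have coefE (F : {set 'I_k}) :
    ((-1) ^+ #|F| * (w #|F|)%:R * \prod_(i in F) fps_t ^+ n i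
      * series_over S g) m =
    if m%:Z - gensum n F \in S
    then (-1) ^+ #|F| * (w #|F|)%:R * g (m%:Z - gensum n F) else 0.
  rewrite -!mulrA fps_coef_signM fps_coef_natM prodrXr fps_coef_tXnM gensumE /=.
  (* Truncated subtraction is the true difference only if n_F <= m; otherwise m - n_F is negative,
     hence outside [S]. *)
  case: leqP => [le|lt]; first by rewrite subzn //; case: ifP; rewrite ?mulr0.
  case: ifP => [|_]; last by rewrite !mulr0.
  by move=> /set_mem/S_ge0; rewrite subr_ge0 lez_nat leqNgt lt.
under eq_bigr do rewrite coefE.
rewrite /=; case: ifP => [_|mS].
  by rewrite -big_mkcond; apply: eq_bigl => F; rewrite inE.
(* For m outside [S] the complex has no faces: a face F would give m = (m - n_F) + n_F in [S]. *)
apply: big1 => F _; case: ifP => // /set_mem mF.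
by rewrite -(subrK (gensum n F) m%:Z) mem_set // in mS; apply: S_add.
Qed.

End FaceSums.

Lemma gensum_generated (k : nat) (n : 'I_k -> nat) (F : {set 'I_k}) :
  generated n (gensum n F).
Proof.
exists (fun i => nat_of_bool (i \in F)); rewrite /gensum big_mkcond.
by apply: eq_bigr => i _; case: (i \in F).
Qed.

Theorem theorem3p8 (R : realType) (k : nat) (n : 'I_k -> nat) (S : set int)
    (n_gt0 : forall i, (0 < n i)%N)
    (n_incr : forall i j : 'I_k, (i < j)%N -> (n i < n j)%N)
    (S_numsg : numerical_semigroup S)
    (S_gen : S = generated n)
    (f : int -> R) (f_inv : semigroup_invariant S f) :
  let z : fps R := \prod_(i < k) (1 / (1 - fps_t ^+ n i)) in
  let lambda : fps R := \sum_(i < k) (fps_t ^+ n i / (1 - fps_t ^+ n i)) in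
  let chi (x : int) : R := (euler_char (sqfree_divisor_complex n S x))%:~R in
  let chi_hat (x : int) : R := aug_euler_char n S f x in
  series_over S f = z * lambda * series_over S chi + z * series_over S chi_hat
  /\
  z * lambda * series_over S chi + z * series_over S chi_hat
    = lambda * hilbert_series R S
      + series_over S chi_hat / \prod_(i < k) (1 - fps_t ^+ n i).
Proof.
move=> z lambda chi chi_hat.
have [S_ge0 _ S_add _] := S_numsg.
have S_gensum F : S (gensum n F) by rewrite S_gen; apply: gensum_generated.
pose P : fps R := \prod_(i < k) (1 - fps_t ^+ n i).
have unitE i : 1 - fps_t ^+ n i \is a @GRing.unit (fps R).
  exact: fps_unit_1subtXn.
have zE : z = P^-1.
  by rewrite /z /P -prodrV //; apply: eq_bigr => i _; rewrite div1r.
have PU : P \is a GRing.unit by apply: rpred_prod => i _; apply: unitE.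
have PlE : P * lambda = - \sum_(F : {set 'I_k})
    (-1) ^+ #|F| * #|F|%:R * \prod_(i in F) fps_t ^+ n i.
  (* Apply the expansion with y_i = t^(n_i): the denominator of the [i]-th term of [lambda] cancels
     the [i]-th factor of [P]. *)
  rewrite -sum_prod_1sub_expand mulr_sumr; apply: eq_bigr => i _.
  by rewrite /P (bigD1 i) //= mulrC mulrA divrK.
have PE (g : int -> R) : P * series_over S g = series_over S (fun x =>
    \sum_(F in sqfree_divisor_complex n S x) (-1) ^+ #|F| * g (x - gensum n F)).
  rewrite /P prod_1sub_expand.
  have := @face_sum_series R k n S S_ge0 S_add S_gensum (fun=> 1%N) g.
  under eq_bigr do rewrite mulr1.
  move=> ->; congr (series_over S _); apply/funext => x.
  by apply: eq_bigr => F _; rewrite mulr1.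
have chiE : series_over S chi = P * hilbert_series R S.
  (* The Hilbert series is the case g = 1 of [PE], where only the signs of the faces remain. *)
  rewrite PE; congr (series_over S _); apply/funext => x.
  rewrite /chi /euler_char rmorph_sum; apply: eq_bigr => F _ /=.
  by rewrite mulr1 rmorphXn /= rmorphN1.
have chi_hatE : series_over S chi_hat =
    P * series_over S f - P * lambda * hilbert_series R S.
  (* The summand f(x - n_F) + |F| splits: the first part comes from [P] times the series of [f], the
     second from weight [id] with g = 1. *)
  rewrite PE PlE mulNr opprK.
  rewrite (@face_sum_series R k n S S_ge0 S_add S_gensum id).
  apply: fpsP => m; rewrite fps_coefD /=; case: ifP => _; last by rewrite addr0.
  rewrite -big_split; apply: eq_bigr => F _ /=.
  by rewrite mulr1 mulrDr.
rewrite zE -/P; have lamH : P^-1 * lambda * series_over S chi =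
    lambda * hilbert_series R S.
  by rewrite chiE mulrAC mulKr // mulrC.
split; rewrite lamH; last by rewrite [P^-1 * _]mulrC.
(* Dividing [chi_hatE] by [P] leaves the series of [f] minus lambda H, and lambda H cancels. *)
by rewrite chi_hatE mulrBr -[P * lambda * _]mulrA !mulKr // addrC subrK.
Qed.
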